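(* Let $n,k\ge 1$ and let $\mathbf{C}=(C_0,C_1,\dots,C_k)$ be a $(k+1)$-tuple of real $n\times n$ matrices such that $C_0$ is invertible and $C_0^{-1}C_i$ is a $Z$-matrix for all $i\in[k]$. The following are equivalent: (i) $\mathbf{C}$ has the cS-$W$ property. (ii) $\mathbf{C}$ has the cone cS-$W$ property.
   Context: Notation: $[m]=\{1,\dots,m\}$; for $u,v\in\mathbb{R}^n$, $u*v$ is the componentwise product, and $u\ge 0$, $u\le 0$ are understood componentwise. $Z$-matrix: a real square matrix whose off-diagonal entries are all nonpositive. cS-$W$ (column sufficient-$W$) property: for all $x_0,x_1,\dots,x_k\in\mathbb{R}^n$ with $C_0x_0=\sum_{i=1}^k C_ix_i$, $x_0*x_i\le 0$ for all $i\in[k]$, and $x_i*x_j\ge 0$ for all $1\le i<j\le k$, one has $x_i*x_{i+1}=0$ for all $0\le i\le k-1$. Cone cS-$W$ property: for all $x_0,x_1,\dots,x_k\in\mathbb{R}^n$ with $C_0x_0=\sum_{i=1}^k C_ix_i$, and $x_i\ge 0$ and $x_0*x_i\le 0$ for all $i\in[k]$, one has $x_i*x_{i+1}=0$ for all $0\le i\le k-1$. *)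

(* Defs.v *)
From mathcomp Require Import all_boot all_order all_algebra.
From mathcomp Require Import reals.

Set Implicit Arguments.
Unset Strict Implicit.
Unset Printing Implicit Defensive.

Import Order.TTheory GRing.Theory Num.Theory.
Local Open Scope ring_scope.

Definition cwmul (R : realType) (n : nat) (u v : 'cV[R]_n) : 'cV[R]_n :=
  map2_mx *%R u v.

Definition cw_ge0 (R : realType) (n : nat) (u : 'cV[R]_n) : Prop :=
  forall r : 'I_n, 0 <= u r 0.

Definition cw_le0 (R : realType) (n : nat) (u : 'cV[R]_n) : Prop :=
  forall r : 'I_n, u r 0 <= 0.

Definition Z_matrix (R : realType) (n : nat) (A : 'M[R]_n) : Prop :=
  forall i j : 'I_n, i != j -> A i j <= 0.

(* A family indexed by 'I_k.+1 is a (k+1)-tuple (X_0, ..., X_k), and [k] is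
   the set of nonzero indices. *)

Definition cS_W (R : realType) (n k : nat) (C : 'I_k.+1 -> 'M[R]_n) : Prop :=
  forall x : 'I_k.+1 -> 'cV[R]_n,
    C ord0 *m x ord0 = \sum_(i < k.+1 | (0 < i)%N) C i *m x i ->
    (forall i : 'I_k.+1, (0 < i)%N -> cw_le0 (cwmul (x ord0) (x i))) ->
    (forall i j : 'I_k.+1, (0 < i)%N -> (i < j)%N ->
       cw_ge0 (cwmul (x i) (x j))) ->
    forall i j : 'I_k.+1, val j = (val i).+1 -> cwmul (x i) (x j) = 0.

Definition cone_cS_W (R : realType) (n k : nat) (C : 'I_k.+1 -> 'M[R]_n) :
    Prop :=
  forall x : 'I_k.+1 -> 'cV[R]_n,
    C ord0 *m x ord0 = \sum_(i < k.+1 | (0 < i)%N) C i *m x i ->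
    (forall i : 'I_k.+1, (0 < i)%N ->
       cw_ge0 (x i) /\ cw_le0 (cwmul (x ord0) (x i))) ->
    forall i j : 'I_k.+1, val j = (val i).+1 -> cwmul (x i) (x j) = 0.

(* Main.v *)
Require Import Defs.
From mathcomp Require Import all_boot all_order all_algebra.
From mathcomp Require Import reals.

(** The cone property is the restriction of the column sufficiency property
    to families with [x i >= 0] for [i > 0], so one direction is immediate.

    For the converse, put [A i := C0^-1 *m C i] and let [x] satisfy the
    hypotheses of the column sufficiency property, so that
    [x 0 = \sum_(i > 0) A i *m x i]. Replace each [x i], [i > 0], by its
    entrywise absolute value [|x i|], and [x 0] by
    [y := \sum_(i > 0) A i *m |x i|]. Every row [r] and every [j > 0] satisfy
<<
      y r * |x j r| <= x 0 r * x j r <= 0.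
>>
    The first inequality ([Z_matrix_mulmx_norm], summed over [i]) is where the
    Z-matrix assumption enters: the off-diagonal entries of [A i] are
    nonpositive, so taking absolute values can only decrease their contribution, while
    the diagonal term [A i r r * x i r * x j r] is unchanged because
    [x i r * x j r >= 0]. The new family is therefore admissible for the cone
    property, which yields [|x i| * |x (i+1)| = 0] for [i > 0], hence
    [x i * x (i+1) = 0], as well as [y * |x 1| = 0]; the latter turns the
    displayed chain for [j = 1] into [0 <= x 0 r * x 1 r <= 0]. *)

Set Implicit Arguments.
Unset Strict Implicit.
Unset Printing Implicit Defensive.

Import Order.TTheory GRing.Theory Num.Theory.
Local Open Scope ring_scope.

Lemma cwmulE (R : realType) (n : nat) (u v : 'cV[R]_n) (r : 'I_n) :
  cwmul u v r 0 = u r 0 * v r 0.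
Proof. by rewrite mxE. Qed.

Lemma cS_W_cone (R : realType) (n k : nat) (C : 'I_k.+1 -> 'M[R]_n) :
  cS_W C -> cone_cS_W C.
Proof.
move=> CS x Cx xP; apply: CS => // [i i_gt0 | i j i_gt0 lt_ij r].
  by case: (xP i i_gt0).
have [xi_ge0 _] := xP i i_gt0.
have [xj_ge0 _] := xP j (ltn_trans i_gt0 lt_ij).
by rewrite cwmulE mulr_ge0.
Qed.

(** In the expansion of the product, the term of column [s] is multiplied by
    [A r s]: for [s != r] this is nonpositive and [u s * v r <= |u s| * |v r|],
    while for [s = r] the sign hypothesis makes both sides equal. *)
Lemma Z_matrix_mulmx_norm (R : realType) (n : nat) (A : 'M[R]_n)
    (u v : 'cV[R]_n) (r : 'I_n) :
  Z_matrix A -> 0 <= u r 0 * v r 0 ->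
  (A *m map_mx Num.norm u) r 0 * `|v r 0| <= (A *m u) r 0 * v r 0.
Proof.
move=> AZ uv_ge0; rewrite !mxE !mulr_suml; apply: ler_sum => s _.
rewrite mxE -!mulrA -normrM.
have [<- | r_neq_s] := eqVneq r s; last by rewrite ler_wnM2l ?ler_norm ?AZ.
by rewrite ger0_norm.
Qed.

Lemma cone_cS_W_Z_matrix (R : realType) (n k : nat) (C : 'I_k.+1 -> 'M[R]_n) :
  C ord0 \in unitmx ->
  (forall i : 'I_k.+1, (0 < i)%N -> Z_matrix (invmx (C ord0) *m C i)) ->
  cone_cS_W C -> cS_W C.
Proof.
move=> C0_unit CZ coneC x Cx x0_le0 x_ge0.
pose absx (i : 'I_k.+1) := map_mx Num.norm (x i).
pose y := \sum_(i < k.+1 | (0 < i)%N) invmx (C ord0) *m C i *m absx i.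
pose z (i : 'I_k.+1) := if i == ord0 then y else absx i.
have zE (i : 'I_k.+1) : (0 < i)%N -> z i = absx i by rewrite /z -val_eqE /= => /gtn_eqF->.
have x0E : x ord0 = \sum_(i < k.+1 | (0 < i)%N) invmx (C ord0) *m C i *m x i.
  rewrite -[LHS](mulKmx C0_unit) Cx mulmx_sumr.
  by apply: eq_bigr => i _; rewrite mulmxA.
have same_sign (i j : 'I_k.+1) r :
  (0 < i)%N -> (0 < j)%N -> 0 <= x i r 0 * x j r 0.
  move=> i_gt0 j_gt0; case: (ltngtP i j) => [lt_ij | lt_ji | /val_inj->].
  - by rewrite -cwmulE x_ge0.
  - by rewrite mulrC -cwmulE x_ge0.
  - by rewrite -expr2 sqr_ge0.
have y_le (j : 'I_k.+1) r :
  (0 < j)%N -> y r 0 * `|x j r 0| <= x ord0 r 0 * x j r 0.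
  move=> j_gt0; rewrite x0E /y !summxE !mulr_suml; apply: ler_sum => i i_gt0.
  by apply: Z_matrix_mulmx_norm; [exact: CZ | exact: same_sign].
have x0j_le0 (j : 'I_k.+1) r : (0 < j)%N -> x ord0 r 0 * x j r 0 <= 0.
  by move=> j_gt0; rewrite -cwmulE x0_le0.
have Cz : C ord0 *m z ord0 = \sum_(i < k.+1 | (0 < i)%N) C i *m z i.
  rewrite /z eqxx mulmx_sumr; apply: eq_bigr => i i_gt0.
  by rewrite -/(z i) zE // -mulmxA mulKVmx.
have z_cone (i : 'I_k.+1) :
  (0 < i)%N -> cw_ge0 (z i) /\ cw_le0 (cwmul (z ord0) (z i)).
  move=> i_gt0; rewrite zE //; split=> r; first by rewrite mxE.
  by rewrite cwmulE mxE /z eqxx (le_trans (y_le i r i_gt0)) ?x0j_le0.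
move=> i j ijE; have j_gt0 : (0 < j)%N by rewrite [nat_of_ord j]ijE.
apply/matrixP=> r c; rewrite (ord1 c) cwmulE mxE.
have := congr1 (fun u : 'cV[R]_n => u r 0) (coneC z Cz z_cone i j ijE).
rewrite cwmulE [RHS]mxE (zE j) // [absx j r 0]mxE.
have [-> | i_neq0] := eqVneq i ord0.
  rewrite /z eqxx => yx_eq0; apply/eqP.
  by rewrite eq_le x0j_le0 //= -yx_eq0 y_le.
have i_gt0 : (0 < i)%N by rewrite lt0n.
by rewrite zE // mxE -normrM => /normr0_eq0.
Qed.

Theorem theorem4p5 (R : realType) (n k : nat) (C : 'I_k.+1 -> 'M[R]_n)
    (n_gt0 : (0 < n)%N) (k_gt0 : (0 < k)%N)
    (C0_unit : C ord0 \in unitmx)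
    (CZ : forall i : 'I_k.+1, (0 < i)%N ->
            Z_matrix (invmx (C ord0) *m C i)) :
  cS_W C <-> cone_cS_W C.
Proof.
by split; [exact: cS_W_cone | exact: cone_cS_W_Z_matrix].
Qed.
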